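(* Consider the random triangle removal process on $n$ vertices. Set $\Phi(p,n)=p^{-2/\log n}\log n$, fix $\alpha>0$, and let \[\tau^*_{\mathrm{Y}}=\min\left\{t : \exists\, u,v \text{ such that } |Y_{u,v}-np^2|>\alpha n^{1/2}p\,\Phi\right\}.\] Then with high probability, for all $t$ with $t\le \tau^*_{\mathrm{Y}}$ and $p(t)\ge n^{-1/2}\log^2 n$, \[\left|Q-n^3p^3/6\right|\le \alpha^2 n^2 p\,\Phi^2.\]
   Context: Random triangle removal process: $G(0)=K_n$ on a vertex set $V_G$ with $|V_G|=n$; as long as $G(i)$ contains a triangle, $G(i+1)$ is obtained by deleting the three edges of a uniformly random triangle of $G(i)$. Write $t=t(i)=i/n^2$ and $p=p(i)=1-6i/n^2$; times $t$ range over values $i/n^2$, $i$ an integer. $Q=Q(i)$ is the number of triangles of $G(i)$, and for distinct vertices $u,v$, $Y_{u,v}=|N_u\cap N_v|$ is their co-degree in $G(i)$. ''With high probability'' means with probability tending to $1$ as $n\to\infty$. *)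

(* Defs.v *)
From HB Require Import structures.
From mathcomp Require Import all_boot all_order all_algebra.
From mathcomp Require Import reals exp.
Set Implicit Arguments. Unset Strict Implicit. Unset Printing Implicit Defensive.
Import Order.TTheory GRing.Theory Num.Theory.
Local Open Scope ring_scope.

(* A graph on vertex set 'I_n is a set of edges; an edge is a 2-element
   subset of 'I_n. *)
Definition graph (n : nat) := {set {set 'I_n}}.

Definition Kn (n : nat) : graph n := [set e : {set 'I_n} | #|e| == 2%N].

Definition is_triangle n (G : graph n) (T : {set 'I_n}) : bool :=
  (#|T| == 3%N) &&
  [forall e : {set 'I_n}, ((e \subset T) && (#|e| == 2%N)) ==> (e \in G)].

Definition triangles n (G : graph n) : {set {set 'I_n}} :=
  [set T | is_triangle G T].

Definition Qcount n (G : graph n) : nat := #|triangles G|.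

Definition remove_tri n (G : graph n) (T : {set 'I_n}) : graph n :=
  G :\: [set e : {set 'I_n} | (e \subset T) && (#|e| == 2%N)].

Definition codeg n (G : graph n) (u v : 'I_n) : nat :=
  #|[set w : 'I_n | ([set u; w] \in G) && ([set v; w] \in G)]|.

(* A trajectory of the process is the sequence s of removed triangles;
   G(i) is the graph after the first i removals. *)
Definition graph_at n (s : seq {set 'I_n}) (i : nat) : graph n :=
  foldl (@remove_tri n) (Kn n) (take i s).

(* Law of the complete trajectory of the random triangle removal process
   started at G: probability that the complete trajectory satisfies E.
   At each step a uniformly random triangle of the current graph is removed;
   the process stops when there are no triangles.  [k] is fuel; any fuel
   >= number of edges / 3 suffices (each step deletes 3 edges). *)
Fixpoint prob_fuel (R : realType) n (k : nat) (G : graph n)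
  (E : seq {set 'I_n} -> bool) : R :=
  if triangles G == set0 then (E [::] : nat)%:R else
  match k with
  | 0 => 0
  | k'.+1 => (#|triangles G|%:R)^-1 *
      \sum_(T in triangles G) prob_fuel R k' (remove_tri G T) (fun s => E (T :: s))
  end.

(* Probability of E for the process started at K_n (n^2 >= #edges/3 steps). *)
Definition trp_prob (R : realType) n (E : seq {set 'I_n} -> bool) : R :=
  prob_fuel R (n ^ 2) (Kn n) E.

Definition pp (R : realType) (n i : nat) : R := 1 - 6 * i%:R / (n%:R ^+ 2).

Definition Phi (R : realType) (n : nat) (p : R) : R :=
  powR p (- 2 / ln n%:R) * ln n%:R.

Definition Yviol (R : realType) n (alpha : R) (s : seq {set 'I_n}) (j : nat) : bool :=
  let p := pp R n j in
  [exists u : 'I_n, exists v : 'I_n,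
     (u != v) &&
     (alpha * Num.sqrt (n%:R) * p * Phi n p <
        `|(codeg (graph_at s j) u v)%:R - n%:R * p ^+ 2|)].

(* The event of the theorem: for every step i of the process (0 <= i <= number
   of steps performed) with i <= tau*_Y (no violation at any step j < i)
   and p(i) >= n^{-1/2} log^2 n, |Q - n^3 p^3 / 6| <= alpha^2 n^2 p Phi^2. *)
Definition good_event (R : realType) n (alpha : R) (s : seq {set 'I_n}) : bool :=
  [forall i : 'I_(size s).+1,
    (( (Num.sqrt (n%:R))^-1 * (ln n%:R) ^+ 2 <= pp R n i) &&
     [forall j : 'I_i, ~~ Yviol alpha s j])
    ==>
    (let p := pp R n i in
     `|(Qcount (graph_at s i))%:R - (n%:R) ^+ 3 * p ^+ 3 / 6| <=
        alpha ^+ 2 * (n%:R) ^+ 2 * p * (Phi n p) ^+ 2)].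

(* Main.v *)
(** Write X = Q - n^3 p^3 / 6, B = alpha^2 n^2 p Phi^2, A = alpha^2 Phi^2 and L = log n.  While no
    co-degree is in violation, E[Q' - Q] = 2 - (1/Q) sum_e Y_e^2 over the edges
    e of G.  By Cauchy-Schwarz and 3 Q = sum_e Y_e, the sum is at least
    9 Q^2 / |G|, and it exceeds this by at most |G| alpha^2 n p^2 Phi^2 since
    every Y_e is that close to n p^2.  Hence when |X| >= B / 2 the drift of X
    towards 0 beats the shrinking of B / 2, and the potential
    (X - B/2)_+^2 + (- X - B/2)_+^2 grows in expectation by at most twice the
    squared one-step change, that is by 2 n L^4, at each of the at most n^2
    steps.  A first failure |X| > B makes it at least (B/2)^2, which is
    at least alpha^4 n^3 L^8 / 4 as p >= n^(-1/2) L^2; so a failure has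
    probability at most 8 / (alpha^4 L^4). *)

Require Import Defs.
From HB Require Import structures.
From mathcomp Require Import all_boot all_order all_algebra.
From mathcomp Require Import reals sequences exp.
From mathcomp Require Import zify ring lra.
Import Order.TTheory GRing.Theory Num.Theory.
Local Open Scope ring_scope.

(** * Edge degrees *)

Section Combinatorics.
Context {n : nat}.
Implicit Types (G : graph n) (T e : {set 'I_n}).

Definition tri_edges T : {set {set 'I_n}} :=
  [set e : {set 'I_n} | (e \subset T) && (#|e| == 2%N)].

(** Co-degree indexed by the edge itself, so that it can be summed over [G]; [edge_degE] identifies
    it with [codeg] of the endpoints. *)
Definition edge_deg G e : nat := #|[set T in triangles G | e \subset T]|.

Lemma card_tri_edges T : #|tri_edges T| = 'C(#|T|, 2).
Proof. by rewrite -cards_draws; apply: eq_card => e; rewrite !inE. Qed.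

Lemma trianglesP G T :
  reflect (#|T| = 3%N /\ tri_edges T \subset G) (T \in triangles G).
Proof.
rewrite inE; apply: (iffP andP) => -[/eqP cT H]; split=> //.
- apply/subsetP=> e; rewrite inE => He; move/forallP: H => /(_ e).
  by move/implyP; apply.
- by apply/forallP=> e; apply/implyP=> He; apply: (subsetP H); rewrite inE.
Qed.

Lemma tri_edgesI T1 T2 : tri_edges (T1 :&: T2) = tri_edges T1 :&: tri_edges T2.
Proof. by apply/setP=> e; rewrite !inE subsetI; case: (#|e| == _); rewrite ?andbT ?andbF. Qed.

Lemma triangles_remove G T : triangles (remove_tri G T) =
  [set T' in triangles G | tri_edges (T :&: T') == set0].
Proof.
apply/setP=> T'; rewrite inE.
have -> : (T' \in triangles G) && (tri_edges (T :&: T') == set0) =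
   (#|T'| == 3%N) && ((tri_edges T' \subset G) && [disjoint tri_edges T & tri_edges T']).
  rewrite tri_edgesI setI_eq0 andbA; congr (_ && _).
  by apply/trianglesP/andP => -[] => [-> ->|/eqP -> ->].
rewrite disjoint_sym -subsetD.
by apply/trianglesP/andP => -[] => [-> ->|/eqP -> ->].
Qed.

(** Double counting of pairs of an edge of [T] and a triangle containing it: the edges shared by [T]
    and [T'] are the 2-subsets of [T :&: T']. *)
Lemma sum_edge_deg_tri G T :
  (\sum_(e in tri_edges T) edge_deg G e =
   \sum_(T' in triangles G) 'C(#|T :&: T'|, 2))%N.
Proof.
rewrite /edge_deg.
under eq_bigr => e _ do rewrite -sum1dep_card.
rewrite (exchange_big_dep (mem (triangles G))) /=; last by move=> e T' _ /andP[].
apply: eq_bigr => T' HT'; rewrite -card_tri_edges -sum1_card.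
apply: eq_bigl => e; rewrite tri_edgesI in_setI ![e \in tri_edges _]inE HT' /=.
by case: (_ == _); rewrite ?andbT ?andbF.
Qed.

(* A triangle [T'] meets [T] in ['C(#|T :&: T'|, 2)] edges: [3] if [T' = T],
   [1] if it is another destroyed triangle, and [0] otherwise. *)
Lemma Qcount_remove G T : T \in triangles G ->
  (Qcount (remove_tri G T) + \sum_(e in tri_edges T) edge_deg G e = Qcount G + 2)%N.
Proof.
move=> HT; have [cT _] := trianglesP _ _ HT.
rewrite sum_edge_deg_tri /Qcount triangles_remove.
rewrite (bigD1 T) //= (cardsD1 T (triangles G)) HT setIid cT.
rewrite -sum1dep_card -sum1_card big_mkcondr /= (bigD1 T) //=.
rewrite -cards_eq0 card_tri_edges setIid cT /= add0n.
rewrite addnCA -big_split /= addnC [(1 + _)%N]addnC -addnA; congr (_ + _)%N.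
rewrite (eq_bigl (fun T' => T' \in triangles G :\ T)); last first.
  by move=> T'; rewrite !inE andbC.
apply: eq_bigr => T'; rewrite !inE => /andP[neT /andP[/eqP cT' _]].
rewrite -cards_eq0 card_tri_edges.
have: (#|T :&: T'| < 3)%N.
  rewrite ltn_neqAle -{2}cT subset_leq_card ?subsetIl // andbT.
  apply/eqP => c3; case/eqP: neT; apply/eqP; rewrite eqEcard cT cT' andbT.
  by apply/setIidPr/eqP; rewrite eqEcard subsetIr c3 cT'.
by case: #|_| => [|[|[|]]].
Qed.

(** Exchange of summation over incident edges and triangles. The weight 1 yields 3 Q, and the weight
    [edge_deg G] yields the sum of squares that governs the expected loss of triangles. *)
Lemma sum_edge_deg_weighted G (f : {set 'I_n} -> nat) : G \subset Kn n ->
  (\sum_(T in triangles G) \sum_(e in tri_edges T) f e =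
   \sum_(e in G) f e * edge_deg G e)%N.
Proof.
move=> /subsetP GK; rewrite (exchange_big_dep (mem G)) /=; last first.
  by move=> T e /trianglesP[_ /subsetP TG] /TG.
apply: eq_bigr => e eG; rewrite sum_nat_const mulnC; congr (_ * _)%N.
rewrite /edge_deg; apply: eq_card => T; rewrite [RHS]inE unfold_in; congr (_ && _).
by have := GK _ eG; rewrite !inE => ->; rewrite andbT.
Qed.

Lemma sum_edge_deg G : G \subset Kn n ->
  (\sum_(e in G) edge_deg G e = 3 * Qcount G)%N.
Proof.
move=> GK; have := sum_edge_deg_weighted G (fun=> 1%N) GK.
under [in RHS]eq_bigr => e _ do rewrite mul1n.
move=> <-; rewrite mulnC -sum_nat_const; apply: eq_bigr => T HT.
by rewrite sum1_card card_tri_edges; case/trianglesP: HT => ->.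
Qed.

Lemma card_remove_tri G T : T \in triangles G ->
  (#|remove_tri G T| + 3 = #|G|)%N.
Proof.
move=> /trianglesP[cT TG]; rewrite /remove_tri -/(tri_edges T).
have -> : 3%N = #|tri_edges T| by rewrite card_tri_edges cT.
by rewrite addnC -(cardsID (tri_edges T) G) (setIidPr TG).
Qed.

(** Sending w to {u, v, w} is a bijection from the common neighbours of u and v to the triangles
    through the edge. *)
Lemma edge_degE G (u v : 'I_n) : G \subset Kn n -> u != v ->
  [set u; v] \in G -> edge_deg G [set u; v] = codeg G u v.
Proof.
move=> /subsetP GK uv uvG.
pose third w : {set 'I_n} := w |: [set u; v].
(* If w were u or v, one of the two sets would be a singleton, which is not in [Kn n]. *)
have notuv w : [set u; w] \in G -> [set v; w] \in G -> w \notin [set u; v].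
  move=> /GK + /GK; rewrite !inE !cards2 => uw vw.
  rewrite negb_or ![w == _]eq_sym.
  by move: uw vw; case: (u != w); case: (v != w).
rewrite /edge_deg /codeg; set W := [set w | ([set u; w] \in G) && _].
have -> : [set T in triangles G | [set u; v] \subset T] = third @: W.
  apply/setP=> T; rewrite inE; apply/andP/imsetP => [[HT sT]|[w]].
    have [cT /subsetP TG] := trianglesP _ _ HT.
    have /cards1P[w Hw] : #|T :\: [set u; v]| == 1%N.
      by rewrite cardsD (setIidPr sT) cT cards2 uv.
    have ET : T = third w by rewrite /third -Hw -[X in _ :|: X](setIidPr sT) setUC setID.
    have : w \in T :\: [set u; v] by rewrite Hw set11.
    rewrite inE => /andP[nw wT].
    exists w => //; rewrite inE; move: nw; rewrite !inE negb_or => /andP[wu wv].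
    have [uT vT] : u \in T /\ v \in T by move: sT; rewrite subUset !sub1set => /andP.
    by apply/andP; split; apply: TG;
      rewrite inE subUset !sub1set ?uT ?vT wT cards2 [_ == w]eq_sym ?wu ?wv.
  rewrite inE => /andP[uw vw] ->; split; last exact: subsetUr.
  have nw := notuv w uw vw.
  apply/trianglesP; split; first by rewrite cardsU1 nw cards2 uv.
  apply/subsetP=> e; rewrite inE => /andP[sub /cards2P[x [y [xy Ee]]]].
  have : (x \in third w) && (y \in third w) by rewrite !(subsetP sub) // Ee !inE eqxx ?orbT.
  rewrite !inE => /andP[/or3P[]/eqP Ex /or3P[]/eqP Ey];
    move: xy; rewrite Ee Ex Ey ?eqxx //= => _; rewrite ?uw ?vw ?uvG // setUC ?uw ?vw ?uvG //.
rewrite card_in_imset // => w1 w2; rewrite inE => /andP[u1 v1].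
rewrite inE => /andP[u2 v2] E12.
have : w1 \in third w2 by rewrite -E12 setU11.
by rewrite in_setU1 (negbTE (notuv _ u1 v1)) orbF => /eqP.
Qed.
End Combinatorics.

(** * Drift estimates *)

Section Estimates.
Context {R : realType}.

Definition pos_part (x : R) : R := Num.max x 0.

Lemma pos_part_ge0 x : 0 <= pos_part x.
Proof. by rewrite le_max lexx orbT. Qed.

Lemma ler_pos_part_sqr x y : x <= y -> pos_part x ^+ 2 <= pos_part y ^+ 2.
Proof.
move=> xy; rewrite ler_sqr ?nnegrE ?pos_part_ge0 //.
by rewrite /pos_part ge_max le_max xy /= pos_part_ge0.
Qed.

(** Second-order Taylor bound: the squared positive part has derivative [2 * pos_part z], which is
    2-Lipschitz. *)
Lemma pos_part_sqrD z h :
  pos_part (z + h) ^+ 2 <= pos_part z ^+ 2 + 2 * pos_part z * h + h ^+ 2.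
Proof.
rewrite /pos_part; case: (leP z 0) => hz; case: (leP (z + h) 0) => hh; nra.
Qed.

(** The linear terms of [pos_part_sqrD] sum to at most 0: by the drift hypothesis if z > 0, and
    because [pos_part z] vanishes otherwise. Only D^2 per term is left. *)
Lemma sum_pos_part_sqr (I : finType) (A : {set I}) (h : I -> R) z D :
  (forall i, i \in A -> `|h i| <= D) -> (0 < z -> \sum_(i in A) h i <= 0) ->
  \sum_(i in A) pos_part (z + h i) ^+ 2 <= #|A|%:R * (pos_part z ^+ 2 + D ^+ 2).
Proof.
move=> hD drift.
apply: le_trans (_ : \sum_(i in A) (pos_part z ^+ 2 + D ^+ 2 + 2 * pos_part z * h i) <= _).
  apply: ler_sum => i iA; apply: le_trans (pos_part_sqrD z (h i)) _.
  have : h i ^+ 2 <= D ^+ 2 by rewrite -real_normK ?num_real // ler_sqr ?nnegrE ?hD // (le_trans _ (hD i iA)).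
  lra.
rewrite big_split /= sumr_const -mulr_sumr -[_ *+ #|_|]mulr_natl.
rewrite gerDl.
have [z0|z0] := ltP 0 z; last by rewrite /pos_part max_r // mulr0 mul0r.
by rewrite mulr_ge0_le0 ?drift // mulr_ge0 ?pos_part_ge0.
Qed.

(** With x = p - q = 6 / n^2 the middle term equals 3 n p^2 - n x (3 p - x), and the correction lies
    between 0 and 18 since n x <= 6 and x <= p <= 1. *)
Lemma cube_step_bounds (n p q : R) : 0 < n -> 0 < p <= 1 -> 0 <= q -> q = p - 6 / n ^+ 2 ->
  1 <= n -> 3 * n * p ^+ 2 - 18 <= n ^+ 3 * (p ^+ 3 - q ^+ 3) / 6 <= 3 * n * p ^+ 2.
Proof.
move=> n0 /andP[p0 p1] q0 Eq n1; set x := 6 / n ^+ 2 in Eq.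
have Ex : n ^+ 2 * x = 6 by rewrite /x mulrCA mulfV ?mulr1 // expf_neq0 // gt_eqF.
have x0 : 0 <= x by rewrite /x divr_ge0 // exprn_ge0 // ltW.
have nx : n * x <= 6 by nra.
have nx0 : 0 <= n * x by apply: mulr_ge0 => //; exact: ltW.
have -> : n ^+ 3 * (p ^+ 3 - q ^+ 3) / 6 =
    n * (n ^+ 2 * x) * (3 * p ^+ 2 - 3 * p * x + x ^+ 2) / 6 by rewrite Eq; field.
have -> : n * (n ^+ 2 * x) * (3 * p ^+ 2 - 3 * p * x + x ^+ 2) / 6 =
    3 * n * p ^+ 2 - n * x * (3 * p - x) by rewrite Ex; field.
by apply/andP; split; nra.
Qed.

(** Here r = sqrt n, L = log n, K = e^2, F = Phi, and d is the co-degree tolerance. In the last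
    bound 3 d comes from the three deleted edges, 20 absorbs the additive constants 2 and 18 of a
    step, and 3 A is the shrinking of the half-width. *)
Lemma scale_estimates (N r L K F al p d A : R) :
  r ^+ 2 = N -> 0 < al -> 1 <= L -> 15 <= al ^+ 2 * L ^+ 2 -> 9 * al * K <= L ->
  60 <= r -> 9 * al ^+ 2 * K ^+ 2 <= r -> 0 < K -> 0 < p -> p <= 1 ->
  L ^+ 2 <= r * p -> L <= F -> F <= K * L ->
  d = al * r * p * F -> A = al ^+ 2 * F ^+ 2 ->
  [/\ 15 <= A, d ^+ 2 = N * p ^+ 2 * A, 0 <= d, 3 * d <= N * p ^+ 2 &
      3 * d + 20 + 3 * A <= r * L ^+ 2].
Proof.
move=> <- al0 L1 hA hK r60 hr K0 p0 p1 rp LF FK -> ->.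
have a2 : 0 < al ^+ 2 by rewrite exprn_gt0.
have L0 : 0 < L by lra.
have F0 : 0 < F by lra.
have r0 : 0 < r by lra.
have LF2 : L ^+ 2 <= F ^+ 2 by rewrite ler_sqr ?nnegrE //; apply: ltW.
have FK2 : F ^+ 2 <= K ^+ 2 * L ^+ 2.
  by rewrite -exprMn ler_sqr ?nnegrE //; apply: ltW => //; apply: mulr_gt0.
have aF : 9 * al * F <= L ^+ 2.
  apply: le_trans (_ : 9 * al * (K * L) <= _); first by rewrite ler_wpM2l //; apply: ltW; rewrite mulr_gt0.
  by rewrite mulrA [L ^+ 2]expr2 ler_wpM2r // ltW.
have aF0 : 0 <= 9 * al * F by nra.
split.
- by apply: le_trans hA _; rewrite ler_pM2l.
- by ring.
- by apply: ltW; rewrite !mulr_gt0.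
- have -> : r ^+ 2 * p ^+ 2 = r * p * (r * p) by ring.
  have -> : 3 * (al * r * p * F) = 3 * al * F * (r * p) by ring.
  by rewrite ler_pM2r ?mulr_gt0 //; lra.
(* Each of 3 d, 3 A and 20 takes at most a third of r L^2. *)
have e1 : 3 * (al * r * p * F) <= r * L ^+ 2 / 3.
  have -> : 3 * (al * r * p * F) = r * (9 * al * F * p) / 3 by field.
  rewrite ler_pM2r ?invr_gt0 // ler_pM2l //; apply: le_trans aF.
  by rewrite ler_piMr.
have e2 : 3 * (al ^+ 2 * F ^+ 2) <= r * L ^+ 2 / 3.
  have : al ^+ 2 * F ^+ 2 <= al ^+ 2 * (K ^+ 2 * L ^+ 2) by rewrite ler_pM2l.
  have : 9 * al ^+ 2 * K ^+ 2 * L ^+ 2 <= r * L ^+ 2 by rewrite ler_pM2r ?exprn_gt0.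
  by lra.
have e3 : 60 * 1 <= r * L ^+ 2 by rewrite ler_pM // expr_ge1 // ltW.
by lra.
Qed.

(** The conclusion is the drift condition multiplied by Q. Cauchy-Schwarz gives S2 >= 18 Q^2 / (n^2
    p), while X >= B / 2 gives 18 Q >= n^2 p (3 n p^2 + 9 A); the surplus 6 A covers the 2. *)
Lemma drift_upper (n p A Q S2 m g : R) :
  0 < n -> 0 < p -> 0 < m -> 2 * m <= n ^+ 2 * p -> 0 < Q ->
  9 * Q ^+ 2 <= m * S2 -> g <= 3 * n * p ^+ 2 -> 1 <= A ->
  n ^+ 2 * p * A / 2 <= Q - n ^+ 3 * p ^+ 3 / 6 ->
  (2 + g + 3 * A) * Q - S2 <= 0.
Proof.
move=> n0 p0 m0 hm Q0 hS hg hA hX.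
have c0 : 0 < n ^+ 2 * p by rewrite mulr_gt0 // exprn_gt0.
have S0 : 0 <= S2 by rewrite -(pmulr_rge0 _ m0) (le_trans _ hS) // mulr_ge0 // sqr_ge0.
have h1 : 18 * Q ^+ 2 <= n ^+ 2 * p * S2 by nra.
have h2 : n ^+ 2 * p * (3 * n * p ^+ 2 + 9 * A) <= 18 * Q by lra.
have h3 : n ^+ 2 * p * (3 * n * p ^+ 2 + 9 * A) * Q <= n ^+ 2 * p * S2.
  by apply: le_trans h1; rewrite [Q ^+ 2]expr2 [18 * _]mulrA ler_pM2r.
rewrite -mulrA ler_pM2l // in h3.
nra.
Qed.

(** Here S2 <= 9 Q^2 / m + m d^2, and the variance term costs at most 9/2 A Q. Against the gain 9 A
    this leaves 3/2 A beyond the required 3 A, which must pay for the constants 6 + 16 = 22; hence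
    15 <= A. *)
Lemma drift_lower (n p A Q S2 m g d : R) :
  0 < n -> 0 < p <= 1 -> 2 <= n * p -> 0 < m -> 2 * m = n ^+ 2 * p - n -> 0 < Q ->
  d ^+ 2 = n * p ^+ 2 * A -> 3 * d <= n * p ^+ 2 -> m * (n * p ^+ 2 - d) <= 3 * Q ->
  m * S2 <= 9 * Q ^+ 2 + m ^+ 2 * d ^+ 2 -> 3 * n * p ^+ 2 - 18 <= g -> 15 <= A ->
  Q - n ^+ 3 * p ^+ 3 / 6 <= - (n ^+ 2 * p * A / 2) ->
  S2 - (2 + g - 3 * A) * Q <= 0.
Proof.
move=> n0 /andP[p0 p1] np m0 hm Q0 d2 hd hQ hS hg hA hX.
have c0 : 0 < n ^+ 2 * p by rewrite mulr_gt0 // exprn_gt0.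
have h1 : m * d ^+ 2 <= 9 / 2 * A * Q.
  have hQ' : 2 * m * (n * p ^+ 2) <= 9 * Q by nra.
  rewrite d2; nra.
(* The extra 6 pays for replacing n^2 p by 2 m = n^2 p - n, which is possible as p <= 1 and n p >=
   2. *)
have h2 : 9 * Q <= m * (3 * n * p ^+ 2 - 9 * A + 6).
  have h3 : 18 * Q <= n ^+ 2 * p * (3 * n * p ^+ 2 - 9 * A) by lra.
  suff : n ^+ 2 * p * (3 * n * p ^+ 2 - 9 * A) <= 2 * m * (3 * n * p ^+ 2 - 9 * A + 6) by lra.
  rewrite hm.
  have : 0 <= 6 * (n ^+ 2 * p - n) - n * (3 * n * p ^+ 2) by nra.
  nra.
have h4 : S2 <= (3 * n * p ^+ 2 - 9 * A + 6 + 9 / 2 * A) * Q.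
  rewrite -(ler_pM2l m0).
  nra.
nra.
Qed.
End Estimates.

(** * Trajectories and the scale Phi *)

Section Process.
Context {R : realType} {n : nat}.
Implicit Types (G : graph n) (s : seq {set 'I_n}).

Definition current s : graph n := foldl (@remove_tri n) (Kn n) s.

(** The invariant of trajectory prefixes used below: a subgraph of [Kn n] that has lost exactly
    three edges per step. *)
Definition reachable s : Prop :=
  current s \subset Kn n /\ (#|current s| + 3 * size s = #|Kn n|)%N.

Lemma current_rcons s T : current (rcons s T) = remove_tri (current s) T.
Proof. by rewrite /current -cats1 foldl_cat. Qed.

Lemma reachable_rcons s T : reachable s -> T \in triangles (current s) ->
  reachable (rcons s T).
Proof.
move=> [sK cs] /card_remove_tri; rewrite /reachable current_rcons size_rcons => cr.
split; first exact: subset_trans (subsetDl _ _) sK.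
by lia.
Qed.

Lemma eq_prob_fuel k G (E1 E2 : seq {set 'I_n} -> bool) :
  E1 =1 E2 -> prob_fuel R k G E1 = prob_fuel R k G E2.
Proof.
elim: k G E1 E2 => [|k IH] G E1 E2 E12 /=; rewrite E12 //.
by case: ifP => // _; congr (_ * _); apply: eq_bigr => T _; apply: IH => s.
Qed.

(** Supermartingale bound: if W dominates the failure indicator at the end and does not increase on
    average in a step, its initial value bounds the failure probability. Fuel at least the number of
    edges never runs out, since every step deletes edges. *)
Lemma prob_fuel_ge (E : seq {set 'I_n} -> bool) (W : seq {set 'I_n} -> R) :
  (forall s, reachable s -> triangles (current s) = set0 -> 1 - W s <= (E s : nat)%:R) ->
  (forall s, reachable s -> triangles (current s) != set0 ->
     \sum_(T in triangles (current s)) W (rcons s T) <=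
     #|triangles (current s)|%:R * W s) ->
  forall k s, reachable s -> (#|current s| <= k)%N ->
    1 - W s <= prob_fuel R k (current s) (fun s' => E (s ++ s')).
Proof.
move=> Wend Wstep; elim=> [|k IH] s rs sk /=; have [tri0|/set0Pn[T0 HT0]] := altP eqP.
- by rewrite cats0; apply: Wend.
- by have := card_remove_tri _ _ HT0; lia.
- by rewrite cats0; apply: Wend.
have tri0 : triangles (current s) != set0 by apply/set0Pn; exists T0.
have c0 : 0 < #|triangles (current s)|%:R :> R by rewrite ltr0n card_gt0.
rewrite mulrC ler_pdivlMr // mulrBl mul1r [W s * _]mulrC.
apply: le_trans (_ : \sum_(T in triangles (current s)) (1 - W (rcons s T)) <= _).
  by rewrite sumrB sumr_const lerD2l lerN2 Wstep.
apply: ler_sum => T HT.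
rewrite (@eq_prob_fuel _ _ _ (fun s' => E (rcons s T ++ s'))); last by move=> s'; rewrite cat_rcons.
rewrite -current_rcons; apply: IH; first exact: reachable_rcons.
by have := card_remove_tri _ _ HT; rewrite current_rcons; lia.
Qed.
End Process.

Section PhiBounds.
Context {R : realType} {n : nat}.
Hypothesis lnn_ge1 : 1 <= ln n%:R :> R.
Implicit Types p q : R.

Lemma PhiE p : 0 < p -> Phi n p = expR (- (2 / ln n%:R * ln p)) * ln n%:R.
Proof. by move=> p0; rewrite /Phi /powR gt_eqF // mulNr mulNr. Qed.

Lemma ler_Phi p q : 0 < q -> q <= p -> Phi n p <= Phi n q.
Proof.
move=> q0 qp; have p0 := lt_le_trans q0 qp; have L0 := lt_le_trans ltr01 lnn_ge1.
rewrite !PhiE // ler_pM2r // ler_expR lerN2 ler_pM2l ?divr_gt0 //.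
by rewrite ler_ln ?posrE.
Qed.

Lemma ln_le_Phi p : 0 < p <= 1 -> ln n%:R <= Phi n p.
Proof.
move=> /andP[p0 p1]; apply: le_trans (ler_Phi _ _ p0 p1).
by rewrite PhiE // ln1 mulr0 oppr0 expR0 mul1r.
Qed.

(** [Phi] decreases in p, and at p = 1 / n the power p^(-2 / log n) is exactly e^2. *)
Lemma Phi_le p : n%:R^-1 <= p -> Phi n p <= expR 2 * ln n%:R.
Proof.
move=> np; have L0 := lt_le_trans ltr01 lnn_ge1.
(* [ln] is 0 at arguments at most 0, so a positive logarithm forces n > 0. *)
have n0 : 0 < n%:R :> R by rewrite ltNge; apply: contraTN L0 => n0; rewrite -leNgt ln0.
have i0 : 0 < n%:R^-1 :> R by rewrite invr_gt0.
apply: le_trans (ler_Phi _ _ i0 np) _.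
by rewrite PhiE // lnV // mulrN opprK divfK ?gt_eqF.
Qed.
End PhiBounds.

(** * The potential *)

Section Potential.
Context {R : realType} {n : nat} (alpha : R).
Implicit Types (G : graph n) (T e : {set 'I_n}) (s : seq {set 'I_n}) (i : nat).

Definition threshold : R := (Num.sqrt n%:R)^-1 * ln n%:R ^+ 2.

Definition width i : R := alpha ^+ 2 * n%:R ^+ 2 * pp R n i * Phi n (pp R n i) ^+ 2.

Definition deviation i G : R := (Qcount G)%:R - n%:R ^+ 3 * pp R n i ^+ 3 / 6.

Definition potential i G : R :=
  pos_part (deviation i G - width i / 2) ^+ 2 +
  pos_part (- deviation i G - width i / 2) ^+ 2.

Definition increment_bound : R := Num.sqrt n%:R * ln n%:R ^+ 2.

Lemma card_Kn : (#|Kn n|)%:R = (n%:R ^+ 2 - n%:R) / 2 :> R.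
Proof.
rewrite /Kn card_draws card_ord.
have : ('C(n, 2) * 2 = n * n.-1)%N by rewrite bin2 muln2 halfK oddM; case: (n) => //= k; rewrite andNb subn0.
move=> /(congr1 (fun k : nat => k%:R : R)); rewrite !natrM => E.
suff E' : n%:R * n.-1%:R = n%:R ^+ 2 - n%:R :> R by lra.
by case: (n) => [|k]; rewrite ?mul0r ?expr0n ?subrr //= -[k.+1]addn1 natrD; ring.
Qed.

Lemma card_Kn_le : (#|Kn n| <= n ^ 2)%N.
Proof.
rewrite /Kn card_draws card_ord bin2; have := leq_mul (leqnn n) (leq_pred n).
by rewrite mulnn; lia.
Qed.

(** Each step deletes 3 edges and lowers n^2 p by 6; the term n comes from 2 |K_n| = n^2 - n. *)
Lemma card_current s : reachable s -> (0 < n)%N ->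
  2 * #|current s|%:R = n%:R ^+ 2 * pp R n (size s) - n%:R.
Proof.
move=> [_ /(congr1 (fun k : nat => k%:R : R))]; rewrite natrD natrM card_Kn => E n0.
have N0 : n%:R != 0 :> R by rewrite pnatr_eq0 -lt0n.
have -> : n%:R ^+ 2 * pp R n (size s) = n%:R ^+ 2 - 6 * (size s)%:R :> R.
  by rewrite /pp; field.
by lra.
Qed.

Lemma edge_deg_moments G (c : R) : G \subset Kn n ->
  \sum_(e in G) ((edge_deg G e)%:R - c) ^+ 2 =
  \sum_(e in G) (edge_deg G e)%:R ^+ 2 - 6 * c * (Qcount G)%:R + #|G|%:R * c ^+ 2.
Proof.
move=> GK; have E : \sum_(e in G) (edge_deg G e)%:R = 3 * (Qcount G)%:R :> R.
  by rewrite -natr_sum sum_edge_deg // natrM.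
under eq_bigr => e _ do rewrite sqrrB.
rewrite big_split /= sumrB sumr_const -[_ *+ #|_|]mulr_natl; congr (_ - _ + _).
by rewrite sumrMnl -mulr_suml E; ring.
Qed.

Lemma card_gt0_of_triangle G T : T \in triangles G -> (0 < #|G|)%N.
Proof. by move=> /card_remove_tri <-; rewrite addn3. Qed.

(** The first bound is nonnegativity of the variance about the mean 3 Q / m. The second expands the
    squared deviations from c and drops the square of 3 Q - m c. The third sums the lower bounds on
    the degrees. *)
Lemma edge_deg_sums G (c d : R) (S2 := \sum_(e in G) (edge_deg G e)%:R ^+ 2)
    (Q : R := (Qcount G)%:R) (m : R := #|G|%:R) :
  G \subset Kn n -> (0 < #|G|)%N ->
  (forall e, e \in G -> `|(edge_deg G e)%:R - c| <= d) ->
  [/\ 9 * Q ^+ 2 <= m * S2, m * S2 <= 9 * Q ^+ 2 + m ^+ 2 * d ^+ 2 &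
      m * (c - d) <= 3 * Q].
Proof.
move=> GK; rewrite -(ltr0n R) -/m => m0 hy; split.
- have : 0 <= \sum_(e in G) ((edge_deg G e)%:R - 3 * Q / m) ^+ 2.
    by apply: sumr_ge0 => e _; apply: sqr_ge0.
  rewrite edge_deg_moments // -/Q -/m -/S2 -(pmulr_rge0 _ m0) -(subr_ge0 (9 * _)).
  suff -> : m * (S2 - 6 * (3 * Q / m) * Q + m * (3 * Q / m) ^+ 2) = m * S2 - 9 * Q ^+ 2 by [].
  by field; rewrite gt_eqF.
- have : \sum_(e in G) ((edge_deg G e)%:R - c) ^+ 2 <= m * d ^+ 2.
    rewrite [m * _]mulr_natl -sumr_const; apply: ler_sum => e eG.
    by rewrite -real_normK ?num_real // ler_sqr ?nnegrE ?hy // (le_trans _ (hy e eG)).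
  rewrite edge_deg_moments // -/Q -/m -/S2 => H.
  have := sqr_ge0 (3 * Q - m * c).
  rewrite -(ler_pM2l m0) in H; lra.
have -> : 3 * Q = \sum_(e in G) (edge_deg G e)%:R by rewrite -natr_sum sum_edge_deg // natrM.
rewrite [m * _]mulr_natl -sumr_const; apply: ler_sum => e /hy.
by rewrite ler_norml => /andP[]; lra.
Qed.

Lemma QcountR_remove G T : T \in triangles G ->
  (Qcount (remove_tri G T))%:R =
  (Qcount G)%:R + 2 - \sum_(e in tri_edges T) (edge_deg G e)%:R :> R.
Proof.
by move=> /Qcount_remove/(congr1 (fun k : nat => k%:R : R)); rewrite !natrD natr_sum; lra.
Qed.

Lemma tri_edges_sum_bound T (f : {set 'I_n} -> R) (c d : R) : #|T| = 3%N ->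
  (forall e, e \in tri_edges T -> `|f e - c| <= d) ->
  `|\sum_(e in tri_edges T) f e - 3 * c| <= 3 * d.
Proof.
move=> cT hf; have cE : #|tri_edges T| = 3%N by rewrite card_tri_edges cT.
have -> : \sum_(e in tri_edges T) f e - 3 * c = \sum_(e in tri_edges T) (f e - c).
  by rewrite sumrB sumr_const cE mulr_natl.
apply: le_trans (ler_norm_sum _ _ _) _; apply: le_trans (ler_sum _ hf) _.
by rewrite sumr_const cE mulr_natl.
Qed.

(* [B / 2] may shrink by [3 * A] in a step; the two drift conditions say that
   the increments still push [X] back towards [-B/2, B/2]. *)
Lemma sum_potential_le (I : finType) (J : {set I}) (h : I -> R) (X B B' A D E : R) :
  B / 2 - 3 * A <= B' / 2 -> 0 <= A -> E + 3 * A <= D ->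
  (forall k, k \in J -> `|h k| <= E) ->
  (0 < X - B / 2 -> \sum_(k in J) h k + #|J|%:R * (3 * A) <= 0) ->
  (0 < - X - B / 2 -> - \sum_(k in J) h k + #|J|%:R * (3 * A) <= 0) ->
  \sum_(k in J) (pos_part (X + h k - B' / 2) ^+ 2 +
                 pos_part (- (X + h k) - B' / 2) ^+ 2) <=
  #|J|%:R * (pos_part (X - B / 2) ^+ 2 + pos_part (- X - B / 2) ^+ 2 + 2 * D ^+ 2).
Proof.
move=> hB A0 hD hE up low.
apply: le_trans (_ : \sum_(k in J)
  (pos_part (X - B / 2 + (h k + 3 * A)) ^+ 2 +
   pos_part (- X - B / 2 + (- h k + 3 * A)) ^+ 2) <= _).
  by apply: ler_sum => k _; apply: lerD; apply: ler_pos_part_sqr; lra.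
rewrite big_split /=.
have -> : forall x y : R, x + y + 2 * D ^+ 2 = x + D ^+ 2 + (y + D ^+ 2) by move=> x z; ring.
rewrite mulrDr; apply: lerD; apply: sum_pos_part_sqr => [k /hE|H].
- by rewrite !ler_norml => /andP[h1 h2]; apply/andP; split; lra.
- by rewrite big_split /= sumr_const -[_ *+ _]mulr_natl; apply: up.
- by rewrite !ler_norml => /andP[h1 h2]; apply/andP; split; lra.
- by rewrite big_split /= sumrN sumr_const -[_ *+ _]mulr_natl; apply: low.
Qed.

(** Both drift lemmas feed [sum_potential_le]. The co-degree bounds concern the present graph, while
    the threshold is imposed on the next p, where the new width is evaluated. *)
Lemma potential_step s (p := pp R n (size s)) (d := alpha * Num.sqrt n%:R * p * Phi n p) :
  0 < alpha -> 1 <= ln n%:R :> R -> 15 <= alpha ^+ 2 * ln n%:R ^+ 2 ->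
  9 * alpha * expR 2 <= ln n%:R -> 60 <= Num.sqrt n%:R :> R ->
  9 * alpha ^+ 2 * expR 2 ^+ 2 <= Num.sqrt n%:R ->
  reachable s -> triangles (current s) != set0 ->
  (forall u v : 'I_n, u != v ->
     `|(codeg (current s) u v)%:R - n%:R * p ^+ 2| <= d) ->
  threshold <= pp R n (size s).+1 ->
  \sum_(T in triangles (current s)) potential (size s).+1 (remove_tri (current s) T) <=
  #|triangles (current s)|%:R * (potential (size s) (current s) + 2 * increment_bound ^+ 2).
Proof.
move=> alpha0 L1 hA hK r60 hr rs tri0 hY.
set q := pp R n (size s).+1; rewrite /threshold => thq.
have hsK := rs.1; set G := current s in rs tri0 hY hsK *.
set r := Num.sqrt n%:R in r60 hr thq *; set L := ln n%:R in L1 hA hK thq.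
set K := expR 2 in hK hr.
have K0 : 0 < K by apply: expR_gt0.
have r2 : r ^+ 2 = n%:R by rewrite sqr_sqrtr ?ler0n.
have r0 : 0 < r by lra.
have n0 : 0 < n%:R :> R by rewrite -r2 exprn_gt0.
have n1 : 1 <= n%:R :> R by rewrite -r2; nra.
have rq : L ^+ 2 <= r * q by rewrite -ler_pdivrMl // mulrC.
have L21 : 1 <= L ^+ 2 by rewrite expr_ge1 // (le_trans ler01).
have q0 : 0 < q by nra.
have Eq : q = p - 6 / n%:R ^+ 2.
  by rewrite /q /p /pp -[(size s).+1]addn1 natrD; field; rewrite gt_eqF.
have qp : q <= p by rewrite Eq gerDl oppr_le0 divr_ge0 // exprn_ge0 // ltW.
have p0 : 0 < p by apply: lt_le_trans qp.
have p1 : p <= 1 by rewrite /p /pp gerDl oppr_le0 divr_ge0 ?mulr_ge0 ?exprn_ge0 ?ler0n.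
have p01 : 0 < p <= 1 by rewrite p0.
have rp : L ^+ 2 <= r * p by apply: le_trans rq _; rewrite ler_pM2l.
have np60 : 60 <= n%:R * p by rewrite -r2; nra.
have np2 : 2 <= n%:R * p by lra.
set F := Phi n p; have dE : d = alpha * r * p * F by [].
clearbody d.
have LF : L <= F by apply: ln_le_Phi.
have FK : F <= K * L by apply: Phi_le => //; rewrite -[_^-1]mul1r ler_pdivrMr // mulrC; lra.
have FF : F <= Phi n q by apply: ler_Phi.
set A := alpha ^+ 2 * F ^+ 2.
have a2 : 0 < alpha ^+ 2 by rewrite exprn_gt0.
have AE : A = alpha ^+ 2 * F ^+ 2 by [].
set D := increment_bound.
have [A15 d2 d0 hd hD] := scale_estimates _ _ _ _ _ _ _ _ _ r2 alpha0 L1 hA hK r60 hr K0 p0 p1 rp LF FK dE AE.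
rewrite -/D in hD.
set B := width (size s).
have EB : B = n%:R ^+ 2 * p * A by rewrite /B /width /A -/p -/F; ring.
set B' := width (size s).+1.
(* As n^2 (p - q) = 6, subtracting 6 A from B replaces p by q but keeps Phi(p), and Phi(p) <=
   Phi(q). *)
have hB : B / 2 - 3 * A <= B' / 2.
  suff : B - 6 * A <= B' by lra.
  have -> : B - 6 * A = alpha ^+ 2 * n%:R ^+ 2 * q * F ^+ 2.
    by rewrite EB Eq /A; field; rewrite gt_eqF.
  rewrite /B' /width -/q ler_pM2l; last by rewrite !mulr_gt0 // exprn_gt0.
  have F0 : 0 <= F by apply: le_trans LF; apply: le_trans L1.
  by rewrite ler_sqr ?nnegrE //; apply: le_trans FF.
set g := n%:R ^+ 3 * (p ^+ 3 - q ^+ 3) / 6.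
have /andP[glo ghi] : 3 * n%:R * p ^+ 2 - 18 <= g <= 3 * n%:R * p ^+ 2.
  by apply: cube_step_bounds => //; lra.
pose y (e : {set 'I_n}) : R := (edge_deg G e)%:R.
have hy e : e \in G -> `|y e - n%:R * p ^+ 2| <= d.
  move=> eG; have := subsetP hsK _ eG; rewrite inE => /cards2P[u [v [uv Ee]]].
  by rewrite /y Ee edge_degE -?Ee //; apply: hY.
(* The one-step change of X: the change of Q plus the decrease g of n^3 p^3 / 6. *)
pose h T : R := 2 - \sum_(e in tri_edges T) y e + g.
have hdev T : T \in triangles G ->
    deviation (size s).+1 (remove_tri G T) = deviation (size s) G + h T.
  by move=> HT; rewrite /deviation QcountR_remove // -/p -/q /h /g /y; field.
have hbound T : T \in triangles G -> `|h T| <= 3 * d + 20.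
  move=> /trianglesP[cT /subsetP TG].
  move: (tri_edges_sum_bound _ _ _ _ cT (fun e eT => hy e (TG e eT))).
  move: glo ghi; rewrite /h !ler_norml; clearbody g; clear.
  by move=> glo ghi /andP[h1 h2]; apply/andP; split; lra.
set Q : R := (Qcount G)%:R; set m : R := #|G|%:R.
pose S2 := \sum_(e in G) y e ^+ 2.
have sumh : \sum_(T in triangles G) h T = (2 + g) * Q - S2.
  rewrite /h big_split sumrB /= !sumr_const -/(Qcount G) -[2 *+ _]mulr_natl -[g *+ _]mulr_natl -/Q.
  suff -> : \sum_(T in triangles G) \sum_(e in tri_edges T) y e = S2 by ring.
  rewrite /y /S2; under eq_bigr => T _ do rewrite -natr_sum.
  rewrite -natr_sum sum_edge_deg_weighted // natr_sum.
  by apply: eq_bigr => e _; rewrite natrM expr2.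
have Q0 : 0 < Q by rewrite ltr0n card_gt0.
have G0 : (0 < #|G|)%N by case/set0Pn: tri0 => T /card_gt0_of_triangle.
have m0 : 0 < m by rewrite ltr0n.
have hm : 2 * m = n%:R ^+ 2 * p - n%:R by apply: card_current => //; rewrite -(ltr0n R).
have [cauchy variance hQ] := edge_deg_sums _ _ _ hsK G0 hy.
rewrite -/S2 -/Q -/m in cauchy variance hQ.
rewrite /potential -/B -/B'.
under eq_bigr => T HT do rewrite hdev //.
apply: (@sum_potential_le _ _ _ _ _ _ A _ _ hB _ hD hbound); first by apply: le_trans A15.
- rewrite sumh -/(Qcount G) -/Q EB /deviation -/Q -/p => H.
  have -> : (2 + g) * Q - S2 + Q * (3 * A) = (2 + g + 3 * A) * Q - S2 by ring.
  apply: (@drift_upper _ n%:R p _ _ _ m) => //.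
  - by rewrite hm gerDl oppr_le0 ltW.
  - by apply: le_trans A15; rewrite ler1n.
  - by rewrite -subr_ge0 ltW.
- rewrite sumh -/(Qcount G) -/Q EB /deviation -/Q -/p => H.
  have -> : - ((2 + g) * Q - S2) + Q * (3 * A) = S2 - (2 + g - 3 * A) * Q by ring.
  apply: (@drift_lower _ n%:R p _ _ _ m _ d) => //.
  by rewrite lerNr -subr_ge0 ltW.
Qed.
End Potential.

(** * Stopping at the first violation *)

Section Cost.
Context {R : realType} {n : nat} (alpha : R).
Implicit Types (T : {set 'I_n}) (s : seq {set 'I_n}) (i : nat).

(** The clause of [good_event] at time i. It depends only on the first i removals, so it is settled
    once they are made. *)
Definition checked s i : bool :=
  ((threshold (R := R) (n := n) <= pp R n i) && [forall j : 'I_i, ~~ Yviol alpha s j]) ==>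
  (`|deviation i (graph_at s i)| <= width (R := R) (n := n) alpha i).

Lemma good_eventP s :
  reflect (forall i, (i <= size s)%N -> checked s i) (good_event alpha s).
Proof.
apply: (iffP forallP) => [H i si|H i]; first exact: (H (Ordinal (si : (i < (size s).+1)%N))).
by apply: H; rewrite -ltnS.
Qed.

Lemma graph_at_rcons s T i : (i <= size s)%N -> graph_at (rcons s T) i = graph_at s i.
Proof. by move=> si; rewrite /graph_at -cats1 takel_cat. Qed.

Lemma graph_at_size s : graph_at s (size s) = current s.
Proof. by rewrite /graph_at take_size. Qed.

Lemma Yviol_rcons s T i : (i <= size s)%N ->
  Yviol alpha (rcons s T) i = Yviol alpha s i.
Proof. by move=> si; rewrite /Yviol graph_at_rcons. Qed.

Lemma checked_rcons s T i : (i <= size s)%N -> checked (rcons s T) i = checked s i.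
Proof.
move=> si; rewrite /checked graph_at_rcons //; congr (_ && _ ==> _).
by apply: eq_forallb => j; rewrite Yviol_rcons // (leq_trans (ltnW (ltn_ord j))).
Qed.

Lemma good_event_rcons s T :
  good_event alpha (rcons s T) = good_event alpha s && checked (rcons s T) (size s).+1.
Proof.
apply/good_eventP/andP => [H|[/good_eventP H1 H2] i].
  split; last by apply: H; rewrite size_rcons.
  by apply/good_eventP => i si; rewrite -(checked_rcons _ T) // H // size_rcons leqW.
by rewrite size_rcons leq_eqVlt => /predU1P[->//|si]; rewrite checked_rcons ?H1.
Qed.

Lemma not_checked s i : ~~ checked s i ->
  threshold (n := n) <= pp R n i /\ width (n := n) alpha i < `|deviation i (graph_at s i)|.
Proof. by rewrite negb_imply -ltNge => /andP[/andP[]]. Qed.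

(** Every later clause is vacuous from here on: a violation has occurred up to and including the
    present step, or p drops below the threshold at the next one. *)
Definition frozen s : bool :=
  [exists j : 'I_(size s).+1, Yviol alpha s j] ||
  (pp R n (size s).+1 < threshold (n := n)).

Lemma ler_pp i j : (i <= j)%N -> pp R n j <= pp R n i.
Proof.
move=> ij; rewrite /pp lerD2l lerN2 ler_wpM2r ?invr_ge0 ?exprn_ge0 //.
by rewrite ler_wpM2l // ler_nat.
Qed.

Lemma frozen_rcons s T : frozen s -> frozen (rcons s T).
Proof.
rewrite /frozen size_rcons => /orP[/existsP[j vj]|lt]; apply/orP; [left|right].
  apply/existsP; exists (widen_ord (leqnSn _) j).
  have jle : (j <= size s)%N := ltn_ord j.
  by rewrite -(Yviol_rcons _ T _ jle) in vj.
exact: le_lt_trans (ler_pp _ _ (leqnSn _)) lt.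
Qed.

Lemma checked_frozen s T : frozen s -> checked (rcons s T) (size s).+1.
Proof.
rewrite /checked => /orP[/existsP[j vj]|lt].
  have jle : (j <= size s)%N := ltn_ord j.
  by apply/implyP => /andP[_ /forallP/(_ j)]; rewrite (Yviol_rcons _ _ _ jle) vj.
by rewrite leNgt lt.
Qed.

(** The square of B / 2 with p replaced by n^(-1/2) L^2 and Phi by L, its lower bounds. *)
Definition fail_level : R :=
  (alpha ^+ 2 * n%:R * Num.sqrt n%:R * ln n%:R ^+ 4 / 2) ^+ 2.

(** Markov-type bound: the potential plus a budget of 2 D^2 for each of the n^2 - i steps still
    allowed, relative to the level reached at a failure. *)
Definition bound s : R :=
  (potential alpha (size s) (current s) +
   (n%:R ^+ 2 - (size s)%:R) * (2 * increment_bound (n := n) ^+ 2)) / fail_level.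

(** The supermartingale for [prob_fuel_ge], absorbed at 1 on failure and at 0 on freezing without
    failure. *)
Definition cost s : R :=
  if ~~ good_event alpha s then 1 else if frozen s then 0 else bound s.

Lemma potential_ge0 i (G : graph n) : 0 <= potential alpha i G.
Proof. by rewrite addr_ge0 // sqr_ge0. Qed.

Lemma size_reachable s : reachable s -> (size s)%:R <= n%:R ^+ 2 :> R.
Proof.
by move=> [_ E]; rewrite -natrX ler_nat; have := @card_Kn_le n; lia.
Qed.

Lemma bound_ge0 s : reachable s -> 0 <= bound s.
Proof.
move=> /size_reachable hs; rewrite /bound divr_ge0 ?sqr_ge0 // addr_ge0 ?potential_ge0 //.
by rewrite mulr_ge0 ?subr_ge0 // mulr_ge0 // sqr_ge0.
Qed.

Lemma cost_ge0 s : reachable s -> 0 <= cost s.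
Proof. by move=> rs; rewrite /cost; case: ifP => // _; case: ifP => // _; apply: bound_ge0. Qed.

Hypothesis alpha_gt0 : 0 < alpha.
Hypothesis lnn_ge1 : 1 <= ln n%:R :> R.
Hypothesis sqrtn_ge60 : 60 <= Num.sqrt n%:R :> R.

Let sqr_sqrtn : Num.sqrt n%:R ^+ 2 = n%:R :> R. Proof. by rewrite sqr_sqrtr. Qed.
Let n_gt0 : 0 < n%:R :> R. Proof. by rewrite -sqr_sqrtn exprn_gt0 // (lt_le_trans _ sqrtn_ge60). Qed.

Lemma fail_level_gt0 : 0 < fail_level.
Proof.
have r0 : 0 < Num.sqrt n%:R :> R by apply: lt_le_trans sqrtn_ge60.
have L0 : 0 < ln n%:R :> R by apply: lt_le_trans lnn_ge1.
by rewrite exprn_gt0 // divr_gt0 // !mulr_gt0 ?exprn_gt0.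
Qed.

Lemma pp_le1 i : pp R n i <= 1.
Proof. by rewrite /pp gerDl oppr_le0 divr_ge0 ?mulr_ge0 ?exprn_ge0. Qed.

(** If |X| > B, one of the two positive parts exceeds B / 2, and B is smallest at the threshold with
    Phi >= L. *)
Lemma fail_level_le i (G : graph n) : threshold (n := n) <= pp R n i ->
  width (n := n) alpha i < `|deviation i G| -> fail_level <= potential alpha i G.
Proof.
set p := pp R n i; set X := deviation i G; set w := width alpha i.
rewrite /threshold; set r := Num.sqrt n%:R; set L := ln n%:R => hp wX.
have r0 : 0 < r by apply: lt_le_trans sqrtn_ge60.
have L0 : 0 < L by apply: lt_le_trans lnn_ge1.
have p0 : 0 < p by apply: lt_le_trans hp; rewrite mulr_gt0 ?invr_gt0 ?exprn_gt0.
have LF : L <= Phi n p by apply: ln_le_Phi => //; rewrite p0 pp_le1.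
have hw : alpha ^+ 2 * n%:R * r * L ^+ 4 <= w.
  have -> : alpha ^+ 2 * n%:R * r * L ^+ 4 = alpha ^+ 2 * n%:R ^+ 2 * (r^-1 * L ^+ 2) * L ^+ 2.
    by rewrite -sqr_sqrtn -/r; field; rewrite gt_eqF.
  rewrite /w /width -/p ler_pM ?mulr_ge0 ?exprn_ge0 ?invr_ge0 // ?(ltW alpha_gt0) ?(ltW L0) ?(ltW r0) //.
    by rewrite ler_pM2l // mulr_gt0 ?exprn_gt0.
  by rewrite ler_sqr ?nnegrE ?(le_trans _ LF) ?(ltW L0).
set z := alpha ^+ 2 * n%:R * r * L ^+ 4 in hw.
have z0 : 0 <= z.
  by rewrite /z !mulr_ge0 ?exprn_ge0 ?(ltW alpha_gt0) ?(ltW L0) ?(ltW r0).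
have w0 : 0 <= w := le_trans z0 hw.
have sqrw : fail_level <= (w / 2) ^+ 2.
  have wz : z / 2 <= w / 2 by lra.
  by rewrite /fail_level -/r -/L -/z ler_sqr // nnegrE; lra.
apply: le_trans sqrw _; rewrite /potential -/X -/w.
have pw : forall x, w / 2 <= x -> (w / 2) ^+ 2 <= pos_part x ^+ 2.
  move=> x wx; rewrite ler_sqr ?nnegrE ?pos_part_ge0 ?divr_ge0 //.
  by rewrite /pos_part le_max wx.
move: wX; rewrite lter_normr => /orP[wX|wX].
  by apply: ler_wpDr; rewrite ?sqr_ge0 // pw //; lra.
by apply: ler_wpDl; rewrite ?sqr_ge0 // pw //; lra.
Qed.

(** The premise makes any failure visible at the present time, where the potential reaches
    [fail_level] and hence [bound] is at least 1. *)
Lemma cost_le s : reachable s ->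
  (~~ good_event alpha s -> ~~ checked s (size s)) -> cost s <= bound s.
Proof.
move=> rs hbad; rewrite /cost; case: ifP => [/hbad/not_checked[thp wX]|_]; last first.
  by case: ifP => // _; apply: bound_ge0.
rewrite graph_at_size in wX.
rewrite /bound ler_pdivlMr ?fail_level_gt0 // mul1r.
apply: ler_wpDr; last exact: fail_level_le.
by rewrite mulr_ge0 ?subr_ge0 ?size_reachable // mulr_ge0 // sqr_ge0.
Qed.

Hypothesis alpha_ln : 15 <= alpha ^+ 2 * ln n%:R ^+ 2.
Hypothesis Phi_ln : 9 * alpha * expR 2 <= ln n%:R.
Hypothesis Phi_sqrtn : 9 * alpha ^+ 2 * expR 2 ^+ 2 <= Num.sqrt n%:R.

(** Failed and frozen prefixes keep their values 1 and 0. Otherwise the expected rise 2 D^2 of the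
    potential is paid by the budget of the step. *)
Lemma cost_step s : reachable s -> triangles (current s) != set0 ->
  \sum_(T in triangles (current s)) cost (rcons s T) <=
  #|triangles (current s)|%:R * cost s.
Proof.
move=> rs tri0.
have [gs|bs] := boolP (good_event alpha s); last first.
  rewrite /cost bs mulr1 -sumr_const; apply: ler_sum => T _.
  by rewrite good_event_rcons (negbTE bs).
have [fs|nfs] := boolP (frozen s).
  rewrite /cost gs fs /= mulr0 big1 // => T _.
  by rewrite good_event_rcons gs checked_frozen // frozen_rcons.
rewrite [cost s]/cost gs (negbTE nfs) /=.
move: nfs; rewrite negb_or -leNgt => /andP[noviol thq].
have hY (u v : 'I_n) : u != v ->
    `|(codeg (current s) u v)%:R - n%:R * pp R n (size s) ^+ 2| <=
    alpha * Num.sqrt n%:R * pp R n (size s) * Phi n (pp R n (size s)).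
  move=> uv; rewrite leNgt; apply: contra noviol => viol.
  apply/existsP; exists ord_max; apply/existsP; exists u; apply/existsP; exists v.
  by rewrite uv /= graph_at_size.
have step := potential_step alpha s alpha_gt0 lnn_ge1 alpha_ln Phi_ln sqrtn_ge60
  Phi_sqrtn rs tri0 hY thq.
apply: le_trans (_ : \sum_(T in triangles (current s)) bound (rcons s T) <= _).
  apply: ler_sum => T HT; apply: cost_le; first exact: reachable_rcons.
  by rewrite good_event_rcons gs size_rcons.
rewrite /bound -mulr_suml mulrA ler_pM2r ?invr_gt0 ?fail_level_gt0 //.
under eq_bigr => T _ do rewrite current_rcons size_rcons.
rewrite big_split /= sumr_const -[_ *+ _]mulr_natl.
apply: le_trans (lerD step (lexx _)) _.
by rewrite -mulrDr -[(size s).+1]addn1 natrD; apply: ler_wpM2l => //; lra.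
Qed.

Lemma Qcount_Kn : (Qcount (Kn n))%:R = n%:R * (n%:R - 1) * (n%:R - 2) / 6 :> R.
Proof.
have -> : Qcount (Kn n) = 'C(n, 3).
  rewrite /Qcount -[n in 'C(n, _)]card_ord -card_draws; apply: eq_card => T.
  rewrite [RHS]inE; apply/trianglesP/eqP => [[]//|cT]; split=> //.
  by apply/subsetP => e; rewrite !inE => /andP[].
have := bin_ffact n 3; rewrite !ffactnS ffactn0 muln1 (_ : 3`! = 6)%N // => /(congr1 (fun k : nat => k%:R : R)).
rewrite [in LHS]natrM !natrM => E.
(* For such n the truncated predecessors agree with the real n - 1 and n - 2. *)
have n3 : (2 < n)%N.
  by rewrite -(ltr_nat R) -sqr_sqrtn; have := sqrtn_ge60; nra.
have E1 : n.-1%:R = n%:R - 1 :> R by rewrite -subn1 natrB // (leq_trans _ n3).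
have E2 : n.-2%:R = n%:R - 2 :> R by rewrite -subn2 natrB // (leq_trans _ n3).
by rewrite E1 E2 in E; lra.
Qed.

Lemma reachable_nil : reachable ([::] : seq {set 'I_n}).
Proof. by split; rewrite ?subxx //= muln0 addn0. Qed.

Lemma cost_nil : cost [::] <= 8 / (alpha ^+ 4 * ln n%:R ^+ 4).
Proof.
have p1 : pp R n 0 = 1 by rewrite /pp mulr0 mul0r subr0.
have r0 : 0 < Num.sqrt n%:R :> R by apply: lt_le_trans sqrtn_ge60.
have L0 : 0 < ln n%:R :> R by apply: lt_le_trans lnn_ge1.
apply: le_trans (cost_le _ reachable_nil _) _.
  apply: contra => H; apply/good_eventP => i; rewrite leqn0 => /eqP ->; exact: H.
rewrite /bound /= subr0.
(* Initially X = - n^2 / 2 + n / 3, and B >= n^2 because alpha^2 Phi^2 >= 15, so both positive parts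
   vanish. *)
have -> : potential alpha 0 (current (n := n) [::]) = 0.
  have LF : ln n%:R <= Phi n (1 : R) by apply: ln_le_Phi; rewrite // ltr01 lexx.
  have F2 : ln n%:R ^+ 2 <= Phi n (1 : R) ^+ 2.
    by rewrite ler_sqr ?nnegrE ?(le_trans _ LF) // ltW.
  have hw : n%:R ^+ 2 <= width (n := n) alpha 0.
    rewrite /width p1 mulr1 [alpha ^+ 2 * _]mulrC -mulrA ler_peMr ?sqr_ge0 //.
    have : alpha ^+ 2 * ln n%:R ^+ 2 <= alpha ^+ 2 * Phi n (1 : R) ^+ 2 by rewrite ler_wpM2l // sqr_ge0.
    by have := alpha_ln; lra.
  have n1 : 1 <= n%:R :> R by rewrite -sqr_sqrtn; have := sqrtn_ge60; nra.
  rewrite (_ : current (n := n) [::] = Kn n) // /potential /deviation Qcount_Kn p1 /pos_part.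
  by rewrite !max_r ?expr0n ?addr0 //; nra.
rewrite add0r /fail_level /increment_bound.
rewrite le_eqVlt; apply/orP; left; apply/eqP.
by field; rewrite (gt_eqF L0) (gt_eqF alpha_gt0) (gt_eqF r0) (gt_eqF n_gt0).
Qed.
End Cost.

(** * Choice of N and conclusion *)

Lemma ln_sqrt_ge (R : realType) (A : R) : exists N : nat, forall n : nat, (N <= n)%N ->
  A <= ln n%:R /\ A <= Num.sqrt n%:R.
Proof.
exists (Num.truncn (expR A + A ^+ 2)).+1 => n hn.
have nb : expR A + A ^+ 2 <= n%:R.
  by apply: le_trans (ltW (truncnS_gt _)) _; rewrite ler_nat.
have e0 := expR_gt0 A; have s0 := sqr_ge0 A.
split.
  rewrite -[A]expRK ler_ln ?posrE //; lra.
apply: le_trans (ler_norm A) _; rewrite -sqrtr_sqr ler_sqrt; lra.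
Qed.

Theorem theorem2p2 (R : realType) (alpha : R) :
  0 < alpha ->
  forall eps : R, 0 < eps ->
  exists N : nat, forall n : nat, (N <= n)%N ->
    1 - eps <= @trp_prob R n (@good_event R n alpha).
Proof.
move=> a0 eps e0.
(* The sum of all lower bounds wanted for log n and sqrt n: 4 / alpha gives alpha^2 L^2 >= 16, and
   the last term gives 8 / (alpha^4 L^4) <= eps through L <= L^4. *)
pose A := 60 + 4 / alpha + 9 * alpha * expR 2 + 9 * alpha ^+ 2 * expR 2 ^+ 2 +
  8 / (alpha ^+ 4 * eps).
have [N hN] := ln_sqrt_ge R A; exists N => n /hN[].
set L := ln n%:R; set r := Num.sqrt n%:R => AL Ar.
have t1 : 0 < 4 / alpha by rewrite divr_gt0.
have t2 : 0 < 9 * alpha * expR 2 by rewrite !mulr_gt0 ?expR_gt0.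
have t3 : 0 < 9 * alpha ^+ 2 * expR 2 ^+ 2 by rewrite !mulr_gt0 ?exprn_gt0 ?expR_gt0.
have t4 : 0 < 8 / (alpha ^+ 4 * eps) by rewrite divr_gt0 ?mulr_gt0 ?exprn_gt0.
have L1 : 1 <= L by rewrite /A in AL; lra.
have r60 : 60 <= r by rewrite /A in Ar; lra.
have aL : 15 <= alpha ^+ 2 * L ^+ 2.
  have : 4 / alpha <= L by rewrite /A in AL; lra.
  rewrite ler_pdivrMr // => h; rewrite -exprMn; nra.
have KL : 9 * alpha * expR 2 <= L by rewrite /A in AL; lra.
have Kr : 9 * alpha ^+ 2 * expR 2 ^+ 2 <= r by rewrite /A in Ar; lra.
apply: le_trans (_ : 1 - cost alpha [::] <= _).
  rewrite lerD2l lerN2; apply: le_trans (cost_nil _ a0 L1 r60 aL) _.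
  have : 8 / (alpha ^+ 4 * eps) <= L by rewrite /A in AL; lra.
  rewrite ler_pdivrMr ?mulr_gt0 ?exprn_gt0 // => h.
  have L0 : 0 < L by lra.
  rewrite ler_pdivrMr ?mulr_gt0 ?exprn_gt0 // -/L.
  have LL : L <= L ^+ 4 by rewrite ler_eXnr.
  have -> : eps * (alpha ^+ 4 * L ^+ 4) = L ^+ 4 * (alpha ^+ 4 * eps) by ring.
  by apply: le_trans h _; rewrite ler_pM2r // mulr_gt0 ?exprn_gt0.
apply: (@prob_fuel_ge R n (good_event alpha) (cost alpha) _ _ _ [::] _ card_Kn_le).
- move=> s rs _; have := cost_ge0 alpha s rs; rewrite /cost.
  by case: (good_event alpha s) => /=; [rewrite lerBlDr lerDl | rewrite subrr].
- by move=> s rs tri0; apply: cost_step.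
- exact: reachable_nil.
Qed.
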